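(* Let the following data be given: (1) a recurrence rule of order $k\ge 1$ of the shape $a(n+k) = F(n, a(n), \dots, a(n+k-1))$ for all $n\in\mathbb{N}$, where $F(n, x_0, \dots, x_{k-1})$ is a known arithmetic term; (2) initial values $a(0), \dots, a(k-1) \in \mathbb{N}$; (3) a function $A(n, x_0, \dots, x_{k-1})$, with $A:\mathbb{N}^{k+1}\to\mathbb{N}$, such that for all $n \in \mathbb{N}$ and all $j$ with $0 \le j \le n$ one has $a(j) < A(n, a(0), \dots, a(k-1))$. Then one can always construct a term $T(n, x_0, \dots, x_{k-1})$ in the language $L_A = \{x+y,\ x\dot{-}y,\ x\cdot y,\ \lfloor x/y \rfloor,\ 2^x\} \cup \{A(n, x_0, \dots, x_{k-1})\}$ such that for all $n \in \mathbb{N}$, $$a(n) = T(n, a(0), \dots, a(k-1)).$$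
   Context: $\mathbb{N}=\{0,1,2,\dots\}$. An arithmetic term is a finite expression built from variables ranging over $\mathbb{N}$ and natural-number constants by composing the operations addition $x+y$, truncated subtraction $x \dot{-} y=\max(x-y,0)$, multiplication $xy$, integer division $\lfloor x/y\rfloor$, remainder $x \bmod y$, and exponentiation $x^y$. Conventions: $x \bmod 0 = x$, and, for definiteness, $\lfloor x/0\rfloor=0$ and $0^0=1$. A term in the language $L_A$ is a finite expression built from the variables by composing the listed functions, the function $A$ being available as an additional function symbol. *)

(* Defs.v *)
From mathcomp Require Import all_boot.

Set Implicit Arguments.
Unset Strict Implicit.
Unset Printing Implicit Defensive.

Inductive aterm (m : nat) : Type :=
| AVar of 'I_m
| AConst of nat
| AAdd of aterm m & aterm m
| ASub of aterm m & aterm m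
| AMul of aterm m & aterm m
| ADiv of aterm m & aterm m
| AMod of aterm m & aterm m
| AExp of aterm m & aterm m.

(* The ssrnat operations already follow the intended conventions: subtraction *)
(* is truncated, x %/ 0 = 0, x %% 0 = x and 0 ^ 0 = 1.                        *)
Fixpoint aeval (m : nat) (v : m.-tuple nat) (t : aterm m) : nat :=
  match t with
  | AVar i => tnth v i
  | AConst c => c
  | AAdd s t => aeval v s + aeval v t
  | ASub s t => aeval v s - aeval v t
  | AMul s t => aeval v s * aeval v t
  | ADiv s t => aeval v s %/ aeval v t
  | AMod s t => aeval v s %% aeval v t
  | AExp s t => aeval v s ^ aeval v t
  end.

(* Terms in m variables in the language                                       *)
(*   x + y, truncated x - y, x * y, x %/ y, 2 ^ x, A(x_0, ..., x_(r-1)),      *)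
(* where A is a function symbol of arity r. There are no constant symbols.    *)
Inductive lterm (r m : nat) : Type :=
| LVar of 'I_m
| LAdd of lterm r m & lterm r m
| LSub of lterm r m & lterm r m
| LMul of lterm r m & lterm r m
| LDiv of lterm r m & lterm r m
| LPow2 of lterm r m
| LApp of ('I_r -> lterm r m).

Fixpoint leval (r m : nat) (A : r.-tuple nat -> nat) (v : m.-tuple nat)
    (t : lterm r m) : nat :=
  match t with
  | LVar i => tnth v i
  | LAdd s t => leval A v s + leval A v t
  | LSub s t => leval A v s - leval A v t
  | LMul s t => leval A v s * leval A v t
  | LDiv s t => leval A v s %/ leval A v t
  | LPow2 s => 2 ^ leval A v s
  | LApp args => A [tuple leval A v (args i) | i < r]
  end.

(* Main.v *)
Require Import Defs.
From mathcomp Require Import all_boot zify.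

(** Call a function of finitely many naturals definable if it is a term in
    [+], truncated [-], [*], [%/] and [2 ^ x]. Remainders and powers are
    definable; reading digits of closed forms in a large base gives binomial
    coefficients and gcds, and then the binary digit sum of [n], which is the
    2-adic valuation of ['C(2 * n, n)].

    The graph of a definable function is the zero set of a nonnegative
    exponential polynomial whose auxiliary unknowns are bounded and uniquely
    determined. The values of an exponential polynomial over a box, packed as
    digits of one number, form a sum of products of geometric-like progressions
    [\sum_(x < t) x ^ r * q ^ x], hence a definable number, and its zeros are
    counted by a binary digit sum (Mazzanti's hypercube method). So definable
    functions are closed under bounded sums.

    If [b] bounds [a 0], ..., [a n], a code [c < b ^ n.+1] whose base-[b] digits
    satisfy the recurrence has [a n] as its leading digit, and being such a code
    is decidable by a bounded sum. Summing the leading digits of all such codes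
    and dividing by their number gives [a n] as a term in [n] and [b]; finally
    [b] is replaced by the value of [A]. *)

Set Implicit Arguments.
Unset Strict Implicit.
Unset Printing Implicit Defensive.

(** * Definable functions and their closure properties *)

Inductive tm : Type :=
| TVar of nat
| TConst of nat
| TAdd of tm & tm
| TSub of tm & tm
| TMul of tm & tm
| TDiv of tm & tm
| TPow2 of tm.

Fixpoint ev (e : nat -> nat) (t : tm) : nat :=
  match t with
  | TVar i => e i
  | TConst c => c
  | TAdd s t => ev e s + ev e t
  | TSub s t => ev e s - ev e t
  | TMul s t => ev e s * ev e t
  | TDiv s t => ev e s %/ ev e t
  | TPow2 s => 2 ^ ev e s
  end.

Definition def (f : (nat -> nat) -> nat) : Prop := exists t, forall e, f e = ev e t.

(** De Bruijn convention: variable 0 is the bound variable of a sum. *)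
Definition scons (x : nat) (e : nat -> nat) (i : nat) : nat :=
  if i is j.+1 then e j else x.

Lemma def_ext f g : def f -> (forall e, f e = g e) -> def g.
Proof. by case=> t Ht fg; exists t => e; rewrite -fg. Qed.

Lemma def_ev t : def (fun e => ev e t).
Proof. by exists t. Qed.

Lemma def_var i : def (fun e => e i).
Proof. by exists (TVar i). Qed.

Lemma def_const c : def (fun=> c).
Proof. by exists (TConst c). Qed.

Lemma def_add f g : def f -> def g -> def (fun e => f e + g e).
Proof. by move=> [s Hs] [t Ht]; exists (TAdd s t) => e; rewrite Hs Ht. Qed.

Lemma def_sub f g : def f -> def g -> def (fun e => f e - g e).
Proof. by move=> [s Hs] [t Ht]; exists (TSub s t) => e; rewrite Hs Ht. Qed.

Lemma def_mul f g : def f -> def g -> def (fun e => f e * g e).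
Proof. by move=> [s Hs] [t Ht]; exists (TMul s t) => e; rewrite Hs Ht. Qed.

Lemma def_div f g : def f -> def g -> def (fun e => f e %/ g e).
Proof. by move=> [s Hs] [t Ht]; exists (TDiv s t) => e; rewrite Hs Ht. Qed.

Lemma def_pow2 f : def f -> def (fun e => 2 ^ f e).
Proof. by move=> [s Hs]; exists (TPow2 s) => e; rewrite Hs. Qed.

Lemma def_succ f : def f -> def (fun e => (f e).+1).
Proof.
by move=> Hf; apply: def_ext (def_add Hf (def_const 1)) _ => e; rewrite addn1.
Qed.

Lemma def_comp f (s : (nat -> nat) -> nat -> nat) :
  def f -> (forall i, def (fun e => s e i)) -> def (fun e => f (s e)).
Proof.
move=> [t Ht] Hs; apply: (@def_ext (fun e => ev (s e) t)); last by move=> e; rewrite Ht.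
elim: t {Ht} => /=; eauto using def_const, def_add, def_sub, def_mul, def_div, def_pow2.
Qed.

Lemma def_mod f g : def f -> def g -> def (fun e => f e %% g e).
Proof.
move=> Hf Hg; apply: def_ext (def_sub Hf (def_mul (def_div Hf Hg) Hg)) _ => e.
by rewrite [X in X - _](divn_eq (f e) (g e)) addKn.
Qed.

(* [2 ^ N] is congruent to [x] modulo [2 ^ N - x]. *)
Lemma expn_modE x y : x ^ y = 2 ^ ((x * y + x + 1) * y) %% (2 ^ (x * y + x + 1) - x).
Proof.
set N := x * y + x + 1.
have lt2 z : z < 2 ^ z by apply: ltn_expl.
(* This puts [x ^ y] below the modulus, so that it is its own remainder. *)
have xyN : x ^ y + x < 2 ^ N.
  have h1 : x ^ y <= 2 ^ (x * y) by rewrite expnM; case: (y) => // y'; rewrite leq_exp2r // ltnW.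
  have h2 := lt2 x; have h3 : 0 < 2 ^ (x * y) by rewrite expn_gt0.
  have : 2 ^ (x * y) + 2 ^ x <= 2 * (2 ^ (x * y) * 2 ^ x).
    have : 0 < 2 ^ x by rewrite expn_gt0.
    nia.
  by rewrite /N addn1 expnS expnD; lia.
have -> : 2 ^ (N * y) = (2 ^ N) ^ y by rewrite expnM.
rewrite -modnXm; have -> : 2 ^ N = x + (2 ^ N - x) by lia.
rewrite -{1}(addKn x (2 ^ N - x)) addKn.
rewrite modnDr modnXm modn_small //; lia.
Qed.

Lemma def_exp f g : def f -> def g -> def (fun e => f e ^ g e).
Proof.
move=> Hf Hg; apply: def_ext (fun e => esym (expn_modE (f e) (g e))).
have HN := def_add (def_add (def_mul Hf Hg) Hf) (def_const 1).
exact: def_mod (def_pow2 (def_mul HN Hg)) (def_sub (def_pow2 HN) Hf).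
Qed.

Lemma def_bigsum (I : Type) (r : seq I) (F : I -> (nat -> nat) -> nat) :
  (forall i, def (F i)) -> def (fun e => \sum_(i <- r) F i e).
Proof.
move=> HF; elim: r => [|i r IH].
  by apply: def_ext (def_const 0) _ => e; rewrite big_nil.
by apply: def_ext (def_add (HF i) IH) _ => e; rewrite big_cons.
Qed.

Lemma def_bigprod (I : Type) (r : seq I) (F : I -> (nat -> nat) -> nat) :
  (forall i, def (F i)) -> def (fun e => \prod_(i <- r) F i e).
Proof.
move=> HF; elim: r => [|i r IH].
  by apply: def_ext (def_const 1) _ => e; rewrite big_nil.
by apply: def_ext (def_mul (HF i) IH) _ => e; rewrite big_cons.
Qed.

Lemma def_eqn f g : def f -> def g -> def (fun e => f e == g e :> nat).
Proof.
move=> Hf Hg.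
apply: def_ext (def_sub (def_const 1) (def_add (def_sub Hf Hg) (def_sub Hg Hf))) _ => e.
by case: eqP; lia.
Qed.

Lemma def_ltn f g : def f -> def g -> def (fun e => f e < g e : nat).
Proof.
move=> Hf Hg.
apply: def_ext (def_sub (def_const 1) (def_sub (def_succ Hf) Hg)) _ => e.
by case: ltnP; lia.
Qed.

(** * Digit extraction *)

Lemma sum_digits_lt X d n :
  (forall j, j < n -> d j < X) -> \sum_(j < n) d j * X ^ j < X ^ n.
Proof.
elim: n => [|n IH] dX; first by rewrite big_ord0.
rewrite big_ord_recr /= expnS.
have ltS := IH (fun j h => dX j (ltnW h)).
by apply: (@leq_trans ((d n).+1 * X ^ n)); [rewrite mulSn ltn_add2r | apply: leq_mul; first exact: dX].
Qed.

Lemma digit_sum X d n i : (forall j, j < n -> d j < X) -> i < n ->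
  (\sum_(j < n) d j * X ^ j) %/ X ^ i %% X = d i.
Proof.
move=> dX lt_in; have X0 : 0 < X by apply: leq_ltn_trans (dX i lt_in).
elim: n lt_in dX => [//|n IH]; rewrite ltnS leq_eqVlt => /orP[/eqP-> | lt_in] dX.
  rewrite big_ord_recr /= addnC divnMDl ?expn_gt0 ?X0 //.
  rewrite divn_small ?addn0 ?modn_small ?dX //.
  by apply: sum_digits_lt => j h; apply: dX; apply: ltnW.
rewrite big_ord_recr /= addnC.
have -> : d n * X ^ n = d n * X ^ (n - i.+1) * X * X ^ i.
  by rewrite -!mulnA -expnS -expnD subnK.
rewrite divnMDl ?expn_gt0 ?X0 // modnMDl; apply: IH => // j h.
by apply: dX; apply: ltnW.
Qed.

(** Exponents may collide; collecting equal ones prepares the sum for the lemmas on digits. *)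
Lemma sum_group_digits (I : finType) (d h : I -> nat) X N : (forall i, h i < N) ->
  \sum_i d i * X ^ h i = \sum_(l < N) (\sum_(i | h i == l) d i) * X ^ l.
Proof.
move=> hN; rewrite (partition_big (fun i => Ordinal (hN i)) xpredT) //=.
apply: eq_bigr => l _; rewrite big_distrl /=.
by apply: eq_big => [i | i /eqP <- //]; rewrite -val_eqE.
Qed.

(** * Geometric progressions *)

Definition gsum (r q t : nat) : nat := \sum_(x < t) x ^ r * q ^ x.

(* Sum the differences of [x ^ r * q ^ x] and expand [(x + 1) ^ r]. *)
Lemma gsum_rec r q t :
  q.-1 * gsum r q t = t ^ r * q ^ t - (0 ^ r + q * \sum_(i < r) 'C(r, i) * gsum i q t).
Proof.
have H : q * (\sum_(i < r.+1) 'C(r, i) * gsum i q t) + 0 ^ r = gsum r q t + t ^ r * q ^ t.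
  transitivity (\sum_(x < t.+1) x ^ r * q ^ x); last by rewrite big_ord_recr.
  rewrite [RHS]big_ord_recl expn0 muln1 [RHS]addnC; congr (_ + _).
  rewrite big_distrr /= (eq_bigr (fun i : 'I_r.+1 => \sum_(x < t) q * ('C(r, i) * (x ^ i * q ^ x)))); last first.
    by move=> i _; rewrite /gsum !big_distrr.
  rewrite exchange_big; apply: eq_bigr => x _; rewrite /bump /= add1n.
  rewrite -(add1n x) expnDn big_distrl /=; apply: eq_bigr => i _.
  by rewrite exp1n mul1n add1n expnS; lia.
move: H; rewrite big_ord_recr /= binn mul1n mulnDr.
case: q => [|q]; first by rewrite !mul0n; lia.
by rewrite mulSn; lia.
Qed.

(** Strong induction on [r]: [gsum_rec] expresses [q - 1] times the sum through smaller exponents,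
    and [1 < q] permits the division. *)
Lemma def_gsum r q t : def q -> def t -> (forall e, 1 < q e) ->
  def (fun e => gsum r (q e) (t e)).
Proof.
move=> Hq Ht q1; elim/ltn_ind: r => r IH.
have Hs : def (fun e => \sum_(i < r) 'C(r, i) * gsum i (q e) (t e)).
  by apply: def_bigsum => i; apply: def_mul (def_const _) (IH _ _).
have H := def_sub (def_mul (def_exp Ht (def_const r)) (def_exp Hq Ht))
            (def_add (def_const (0 ^ r)) (def_mul Hq Hs)).
apply: def_ext (def_div H (def_sub Hq (def_const 1))) _ => e.
by rewrite -gsum_rec subn1 mulKn // -subn1 subn_gt0.
Qed.

(** * Greatest common divisors and binary digit sums *)

(** For each [i] there is at most one [j], and there is one exactly when [b] divides [a * i.+1],
    that is, when [b %/ gcdn a b] divides [i.+1]. The interval from 1 to [b] contains [gcdn a b]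
    such multiples. *)
Lemma sum_dvdn_mul a b : 0 < a -> 0 < b ->
  \sum_(p : 'I_b * 'I_a | a * p.1.+1 + b * p.2 == a * b) 1 = gcdn a b.
Proof.
move=> a0 b0; transitivity (\sum_(i < b) \sum_(j < a) (a * i.+1 + b * j == a * b)).
  by rewrite pair_big /= [LHS]big_mkcond /=; apply: eq_bigr => p _; case: eqP.
transitivity (\sum_(i < b) (b %| a * i.+1)).
  apply: eq_bigr => i _; case: (boolP (b %| _)) => [/dvdnP[c Ec] | ndvd].
    have c0 : 0 < c by case: c Ec => //; nia.
    have ca : c <= a by rewrite -(leq_pmul2r b0) -Ec leq_mul2l ltn_ord orbT.
    have lt : a - c < a by lia.
    rewrite (bigD1 (Ordinal lt)) //= big1 ?addn0 ?Ec.
      by case: eqP => //; rewrite mulnBr; nia.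
    move=> j; rewrite -val_eqE /= => nej; case: eqP => // E.
    by case/eqP: nej; apply/eqP; rewrite -(eqn_pmul2l b0) mulnBr; lia.
  rewrite big1 // => j _; case: eqP => // E; case/negP: ndvd.
  by rewrite -(dvdn_addl _ (dvdn_mulr j (dvdnn b))) E dvdn_mull.
set g := gcdn a b; have g0 : 0 < g by rewrite gcdn_gt0 a0.
have [Ea Eb] : a = a %/ g * g /\ b = b %/ g * g.
  by rewrite !divnK ?dvdn_gcdl ?dvdn_gcdr.
transitivity (\sum_(1 <= i < b.+1) (b %/ g %| i)).
  rewrite big_add1 big_mkord; apply: eq_bigr => i _; congr (nat_of_bool _).
  rewrite {1}Eb {1}Ea mulnAC dvdn_pmul2r // Gauss_dvdr //.
  by rewrite /coprime -(eqn_pmul2r g0) mul1n muln_gcdl -Ea -Eb gcdnC.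
rewrite -divn_count_dvd {1}Eb mulKn //.
by rewrite divn_gt0 // dvdn_leq // dvdn_gcdr.
Qed.

(* The coefficient of [X ^ (a * b)] in
   [(X ^ a + X ^ (2 * a) + ... + X ^ (b * a)) * (1 + X ^ b + ... + X ^ ((a - 1) * b))]
   is [gcdn a b]. *)
Lemma gcdn_digitE a b X : 0 < a -> 0 < b -> a * b < X ->
  X ^ a * gsum 0 (X ^ a) b * gsum 0 (X ^ b) a %/ X ^ (a * b) %% X = gcdn a b.
Proof.
move=> a0 b0 abX.
have -> : X ^ a * gsum 0 (X ^ a) b * gsum 0 (X ^ b) a =
          \sum_(p : 'I_b * 'I_a) 1 * X ^ (a * p.1.+1 + b * p.2).
  rewrite -(pair_bigA _ (fun (i : 'I_b) (j : 'I_a) => 1 * X ^ (a * i.+1 + b * j))) /=.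
  rewrite /gsum -mulnA big_distrl big_distrr /=; apply: eq_bigr => i _.
  rewrite !big_distrr /=; apply: eq_bigr => j _.
  by rewrite !expn0 !mul1n expnD mulnS expnD -!expnM mulnA.
rewrite (@sum_group_digits _ _ _ _ (2 * (a * b)).+1); last first.
  by case=> i j /=; have := ltn_ord i; have := ltn_ord j; nia.
(* Each coefficient is at most the number [a * b] of pairs, hence a digit in base [X]. *)
pose cnt l := \sum_(p : 'I_b * 'I_a | a * p.1.+1 + b * p.2 == l) 1.
rewrite (@digit_sum X cnt) ?ltnS ?leq_pmull // /cnt ?sum_dvdn_mul // => l _.
apply: leq_ltn_trans abX; rewrite sum1_card; apply: leq_trans (max_card _) _.
by rewrite card_prod !card_ord mulnC.
Qed.

Lemma def_gcdn f g : def f -> def g -> (forall e, 0 < f e) -> (forall e, 0 < g e) ->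
  def (fun e => gcdn (f e) (g e)).
Proof.
move=> Hf Hg f0 g0; have Hfg := def_mul Hf Hg; have HX := def_pow2 Hfg.
pose X e := 2 ^ (f e * g e).
have X1 e : 1 < X e by apply: leq_ltn_trans (ltn_expl _ (ltnSn 1)); rewrite muln_gt0 f0 g0.
have gt1 (h : (nat -> nat) -> nat) e : 0 < h e -> 1 < X e ^ h e.
  by move=> h0; apply: leq_ltn_trans h0 (ltn_expl _ (X1 e)).
have H1 := def_mul (def_exp HX Hf) (@def_gsum 0 _ _ (def_exp HX Hf) Hg (fun e => gt1 f e (f0 e))).
have H2 := @def_gsum 0 _ _ (def_exp HX Hg) Hf (fun e => gt1 g e (g0 e)).
apply: def_ext (def_mod (def_div (def_mul H1 H2) (def_exp HX Hfg)) HX) _ => e.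
by rewrite gcdn_digitE // ltn_expl.
Qed.

(** The binomial expansion of [(1 + X) ^ n] has no carries, its coefficients being at most
    [2 ^ n]. *)
Lemma bin_digitE n j X : 2 ^ n < X -> j <= n -> X.+1 ^ n %/ X ^ j %% X = 'C(n, j).
Proof.
move=> nX jn; rewrite -add1n expnDn.
rewrite (eq_bigr (fun i : 'I_n.+1 => 'C(n, i) * X ^ i)); last by move=> i _; rewrite exp1n mul1n.
rewrite (@digit_sum X (fun i => 'C(n, i))) // => i _; apply: leq_ltn_trans nX.
case: (leqP i n) => [le_in | /bin_small-> //].
rewrite -[2]/(1 + 1) expnDn (bigD1 (Ordinal (le_in : i < n.+1))) //= !exp1n !muln1.
by rewrite leq_addr.
Qed.

Lemma def_bin f g : def f -> def g -> (forall e, g e <= f e) ->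
  def (fun e => 'C(f e, g e)).
Proof.
move=> Hf Hg gf; have HX := def_pow2 (def_succ Hf).
apply: def_ext (def_mod (def_div (def_exp (def_succ HX) Hf) (def_exp HX Hg)) HX) _ => e.
by rewrite bin_digitE // ltn_exp2l.
Qed.

(** The Hamming weight of [n], in a form that gcds make definable. *)
Definition hw (n : nat) : nat := logn 2 'C(n.*2, n).

Lemma logn2_fact_double n : logn 2 (n.*2)`! = n + logn 2 n`!.
Proof.
elim: n => [//|n IH]; rewrite doubleS !factS.
rewrite !lognM ?muln_gt0 ?fact_gt0 // IH.
have -> : n.*2.+2 = 2 * n.+1 by lia.
rewrite lognM // (@lognE 2 2) /= (@logn_coprime 2 n.*2.+1) ?coprime2n /= ?odd_double //.
by rewrite add0n divnn logn1; lia.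
Qed.

(** Legendre's formula, read off from the factorial form of the central binomial coefficient. *)
Lemma hw_logn_fact n : hw n + logn 2 n`! = n.
Proof.
have nn : n <= n.*2 by lia.
have := congr1 (logn 2) (bin_fact nn); have -> : n.*2 - n = n by lia.
rewrite !lognM ?muln_gt0 ?fact_gt0 ?bin_gt0 // logn2_fact_double -/(hw n); lia.
Qed.

Lemma hw_leq n : hw n <= n.
Proof. by rewrite -{2}(hw_logn_fact n) leq_addr. Qed.

(** This recursion identifies [hw] as the binary digit sum; an odd last factor does not change the
    2-adic valuation of the factorial. *)
Lemma hwE n : hw n = odd n + hw n./2.
Proof.
have F : logn 2 n`! = n./2 + logn 2 (n./2)`!.
  rewrite -{1}(odd_double_half n) -logn2_fact_double; case: (odd n) => //.
  rewrite add1n factS lognM ?fact_gt0 // (@logn_coprime 2 _.*2.+1) //.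
  by rewrite coprime2n /= odd_double.
have := hw_logn_fact n; have := hw_logn_fact n./2; have := odd_double_half n; lia.
Qed.

Lemma hw0 : hw 0 = 0. Proof. by have := hw_leq 0; lia. Qed.

Lemma hwD u a b : a < 2 ^ u -> hw (a + 2 ^ u * b) = hw a + hw b.
Proof.
elim: u a => [|u IH] a.
  by rewrite expn0 ltnS leqn0 => /eqP->; rewrite add0n mul1n hw0.
rewrite expnS => lta; have lta2 : a./2 < 2 ^ u by lia.
rewrite hwE (hwE a) -addnA -IH //; congr (_ + hw _).
  by rewrite oddD -mulnA oddM /= addbF.
by rewrite -mulnA mul2n halfD odd_double andbF add0n doubleK.
Qed.

(** [2 ^ u - a.+1] is the complement of [a] on [u] bits. *)
Lemma hw_compl u a : a < 2 ^ u -> hw (2 ^ u - a.+1) + hw a = u.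
Proof.
elim: u a => [|u IH] a; first by rewrite expn0 ltnS leqn0 => /eqP->; rewrite hw0.
rewrite expnS => lta; have lta2 : a./2 < 2 ^ u by lia.
rewrite hwE (hwE a).
have -> : (2 * 2 ^ u - a.+1)./2 = 2 ^ u - a./2.+1 by lia.
have -> : odd (2 * 2 ^ u - a.+1) = ~~ odd a by rewrite oddB // oddM.
by rewrite -[RHS]addn1 -{2}(IH _ lta2); case: (odd a); lia.
Qed.

(* For [0 < a] the product is [2 ^ u * a.-1 + (2 ^ u - a)], and the binary
   digits of the two parts are complementary. *)
Lemma hw_mersenne_mul u a : a <= 2 ^ u -> hw ((2 ^ u).-1 * a) = u * (0 < a).
Proof.
case: a => [|a] lta; first by rewrite !muln0 hw0.
rewrite muln1 -{2}(hw_compl lta) -(@hwD u); last by have := expn_gt0 2 u; lia.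
congr hw; have := expn_gt0 2 u; nia.
Qed.

Lemma hw_sum w (d : nat -> nat) n : (forall j, d j < 2 ^ w) ->
  hw (\sum_(j < n) d j * (2 ^ w) ^ j) = \sum_(j < n) hw (d j).
Proof.
move=> dw; elim: n => [|n IH]; first by rewrite !big_ord0 hw0.
rewrite !big_ord_recr /= -IH -expnM mulnC hwD // expnM.
by apply: sum_digits_lt.
Qed.

(** By injectivity each position receives at most one digit, so [hw_sum] applies after grouping. *)
Lemma hw_sum_inj (I : finType) w (d h : I -> nat) : injective h ->
  (forall i, d i < 2 ^ w) ->
  hw (\sum_i d i * (2 ^ w) ^ h i) = \sum_i hw (d i).
Proof.
move=> hinj dw; pose N := (\max_i h i).+1.
have hN i : h i < N by rewrite ltnS; apply: leq_bigmax.
have single (D : I -> nat) i : \sum_(j | h j == h i) D j = D i.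
  by apply: big_pred1 => j; rewrite (inj_eq hinj).
have none (D : I -> nat) l : (forall i, h i != l) -> \sum_(j | h j == l) D j = 0.
  by move=> hl; rewrite big_pred0 // => j; apply: negbTE.
rewrite (sum_group_digits _ _ hN) (@hw_sum w (fun l => \sum_(i | h i == l) d i)); last first.
  move=> l; case: (pickP (fun i => h i == l)) => [i /eqP<- | nol].
    by rewrite single.
  by rewrite none ?expn_gt0 // => i; rewrite nol.
rewrite [RHS](partition_big (fun i => Ordinal (hN i)) xpredT) //=.
apply: eq_bigr => l _; rewrite [RHS](eq_bigl (fun i => h i == l)); last first.
  by move=> i; rewrite -val_eqE.
case: (pickP (fun i => h i == l)) => [i /eqP<- | nol]; first by rewrite !single.
by rewrite !none ?hw0 // => i; rewrite nol.
Qed.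

(* [(2 ^ e) ^ K = (1 + z) ^ e], which is [1 + e * z] modulo [z ^ 2]. *)
Lemma log2_modE e K z : z = (2 ^ K).-1 -> e < z -> 1 < z ->
  (2 ^ e) ^ K %% z ^ 2 %/ z = e.
Proof.
move=> Ez ez z1; have -> : (2 ^ e) ^ K = z.+1 ^ e.
  by rewrite -expnM mulnC expnM Ez prednK ?expn_gt0.
have : z.+1 ^ e = e * z + 1 %[mod z ^ 2].
  elim: e {ez} => [|e IH]; first by rewrite expn0.
  rewrite expnS -modnMmr IH modnMmr.
  have -> : z.+1 * (e * z + 1) = e * z ^ 2 + (e.+1 * z + 1) by nia.
  by rewrite modnMDl.
move=> ->; rewrite modn_small; last by nia.
by rewrite divnMDl 1?ltnW // divn_small ?addn0.
Qed.

Lemma gcdn_pow2 y n : 0 < y -> logn 2 y <= n -> gcdn y (2 ^ n) = 2 ^ logn 2 y.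
Proof.
move=> y0 yn; have [m cop Ey] := pfactor_coprime (isT : prime 2) y0.
rewrite gcdnC {1}Ey Gauss_gcdr ?coprimeXl //.
by rewrite gcdnC; apply/gcdn_idPl; rewrite dvdn_exp2l.
Qed.

Lemma def_hw f : def f -> def (fun e => hw (f e)).
Proof.
move=> Hf; have H2 := def_mul (def_const 2) Hf.
have Hy : def (fun e => 'C((f e).*2, f e)).
  apply: def_ext (def_bin H2 Hf _) _ => e; rewrite mul2n //; lia.
(* Since [hw n <= n], the gcd with [2 ^ n] is the full power of 2 in the binomial coefficient. *)
have Hg : def (fun e => 2 ^ hw (f e)).
  apply: def_ext (def_gcdn Hy (def_pow2 Hf) _ _) _ => e; rewrite ?bin_gt0 ?expn_gt0 //.
    by lia.
  by rewrite gcdn_pow2 ?hw_leq ?bin_gt0 //; lia.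
(* With [K = n + 2], [z = 2 ^ K - 1] exceeds both 1 and [hw n], as [log2_modE] requires. *)
have HK := def_add Hf (def_const 2).
have Hz := def_sub (def_pow2 HK) (def_const 1).
apply: def_ext (def_div (def_mod (def_exp Hg HK) (def_exp Hz (def_const 2))) Hz) _ => e.
have := ltn_expl (f e) (ltnSn 1); have := hw_leq (f e) => h1 h2.
by apply: log2_modE; rewrite subn1 // expnD; lia.
Qed.

(** * Exponential polynomials and their zeros in a box *)

(* [(c, r, s)] stands for [c * \prod_(i < k) x_i ^ r_i * 2 ^ (s_i * x_i)]; the
   coefficient [c] may depend on the environment but not on [x]. *)
Definition mono_eval k (e x : nat -> nat) (m : tm * (nat -> nat) * (nat -> nat)) : nat :=
  ev e m.1.1 * \prod_(i < k) (x i ^ m.1.2 i * (2 ^ m.2 i) ^ x i).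

Definition expoly k (P : (nat -> nat) -> (nat -> nat) -> nat) : Prop :=
  exists l, forall e x, P e x = \sum_(m <- l) mono_eval k e x m.

Lemma expoly_coef k f : def f -> expoly k (fun e _ => f e).
Proof.
case=> t Ht; exists [:: (t, fun=> 0, fun=> 0)] => e x.
by rewrite big_seq1 /mono_eval big1 ?muln1 //= => i _; rewrite exp1n.
Qed.

Lemma expoly_var k i : i < k -> expoly k (fun _ x => x i).
Proof.
move=> ik; exists [:: (TConst 1, fun j => j == i : nat, fun=> 0)] => e x.
rewrite big_seq1 /mono_eval mul1n (bigD1 (Ordinal ik)) //= eqxx exp1n expn1 muln1.
rewrite big1 ?muln1 // => j; rewrite -val_eqE /= => /negbTE->.
by rewrite exp1n.
Qed.

Lemma expoly_pow2 k i : i < k -> expoly k (fun _ x => 2 ^ x i).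
Proof.
move=> ik; exists [:: (TConst 1, fun=> 0, fun j => j == i : nat)] => e x.
rewrite big_seq1 /mono_eval mul1n (bigD1 (Ordinal ik)) //= eqxx mul1n.
rewrite big1 ?muln1 // => j; rewrite -val_eqE /= => /negbTE->.
by rewrite exp1n.
Qed.

Lemma expoly_add k P Q : expoly k P -> expoly k Q -> expoly k (fun e x => P e x + Q e x).
Proof. by move=> [p Hp] [q Hq]; exists (p ++ q) => e x; rewrite big_cat Hp Hq. Qed.

Lemma expoly_mul k P Q : expoly k P -> expoly k Q -> expoly k (fun e x => P e x * Q e x).
Proof.
move=> [p Hp] [q Hq].
exists [seq (TMul m.1.1 m'.1.1, fun i => m.1.2 i + m'.1.2 i, fun i => m.2 i + m'.2 i)
          | m <- p, m' <- q] => e x.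
rewrite Hp Hq big_distrl big_allpairs_dep; apply: eq_bigr => m _.
rewrite big_distrr; apply: eq_bigr => m' _; rewrite /mono_eval /=.
rewrite mulnACA -big_split /=; congr (_ * _); apply: eq_bigr => i _.
by rewrite !expnD expnMn mulnACA.
Qed.

(** Every monomial is monotone, so the top corner of a box bounds the values on it. *)
Lemma expoly_leq k P e x y : expoly k P -> (forall i, i < k -> x i <= y i) -> P e x <= P e y.
Proof.
case=> l Hl xy; rewrite !Hl; apply: leq_sum => m _; rewrite leq_mul2l.
apply/orP; right; apply: leq_prod => i _; apply: leq_mul.
  by case: (m.1.2 i) => // r; rewrite leq_exp2r ?xy.
by rewrite leq_pexp2l ?expn_gt0 ?xy.
Qed.

Lemma def_expoly k P s : expoly k P -> (forall i, def (fun e => s e i)) ->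
  def (fun e => P e (s e)).
Proof.
case=> l Hl Hs; apply: def_ext (fun e => esym (Hl e (s e))).
apply: def_bigsum => m; apply: def_mul (def_ev _) _; apply: def_bigprod => i.
by apply: def_mul (def_exp (Hs i) (def_const _)) (def_exp (def_const _) (Hs i)).
Qed.

Definition ffun_ext k U (f : {ffun 'I_k -> 'I_U}) (i : nat) : nat :=
  if insub i is Some j then f j : nat else 0.

Lemma ffun_extE k U (f : {ffun 'I_k -> 'I_U}) (i : 'I_k) : ffun_ext f i = f i.
Proof. by rewrite /ffun_ext valK. Qed.

Lemma ffun_ext_lt k U (f : {ffun 'I_k -> 'I_U.+1}) i : ffun_ext f i < U.+1.
Proof. by rewrite /ffun_ext; case: insub => // j; apply: ltn_ord. Qed.

Definition ffun_rank k U (f : {ffun 'I_k -> 'I_U}) : nat :=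
  \sum_(i < k) f i * U ^ i.

Lemma ffun_rank_inj k U : injective (@ffun_rank k U.+1).
Proof.
move=> f g fg; apply/ffunP => i; apply: val_inj => /=.
rewrite -!ffun_extE -(@digit_sum U.+1 (ffun_ext f) k i) ?ltn_ord //; last first.
  by move=> j _; apply: ffun_ext_lt.
rewrite -[RHS](@digit_sum U.+1 (ffun_ext g) k i) ?ltn_ord //; last first.
  by move=> j _; apply: ffun_ext_lt.
move: fg; rewrite /ffun_rank; under eq_bigr do rewrite -ffun_extE.
by under [X in _ = X -> _]eq_bigr do rewrite -ffun_extE; move=> ->.
Qed.

(** [W ^ ffun_rank f] splits into one factor per coordinate, so distributivity turns the sum over
    the box into a product of one-variable sums. *)
Lemma box_sum_mono k U W e m :
  \sum_(f : {ffun 'I_k -> 'I_U}) mono_eval k e (ffun_ext f) m * W ^ ffun_rank f =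
  ev e m.1.1 * \prod_(i < k) gsum (m.1.2 i) (2 ^ m.2 i * W ^ (U ^ i)) U.
Proof.
rewrite /gsum bigA_distr_bigA big_distrr /=; apply: eq_bigr => f _.
rewrite /mono_eval -mulnA; congr (_ * _).
rewrite /ffun_rank expn_sum -big_split /=; apply: eq_bigr => i _.
by rewrite ffun_extE expnMn mulnA (mulnC (f i : nat)) expnM.
Qed.

Lemma def_box_sum k P U W : expoly k P -> def U -> def W ->
  (forall e, 1 < W e) ->
  def (fun e => \sum_(f : {ffun 'I_k -> 'I_(U e).+1}) P e (ffun_ext f) * W e ^ ffun_rank f).
Proof.
case=> l Hl HU HW W1.
have H : def (fun e => \sum_(m <- l)
    ev e m.1.1 * \prod_(i < k) gsum (m.1.2 i) (2 ^ m.2 i * W e ^ ((U e).+1 ^ i)) (U e).+1).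
  apply: def_bigsum => m; apply: def_mul (def_ev _) _; apply: def_bigprod => i.
  have HU1 := def_succ HU; apply: def_gsum => //.
    apply: def_mul (def_const _) (def_exp HW (def_exp HU1 (def_const _))).
  move=> e; have h : 1 < W e ^ (U e).+1 ^ i.
    by apply: leq_ltn_trans (ltn_expl _ (W1 e)); rewrite expn_gt0.
  by apply: leq_trans h _; rewrite leq_pmull ?expn_gt0.
apply: def_ext H _ => e; under eq_bigr => m _ do rewrite -box_sum_mono.
by rewrite exchange_big; apply: eq_bigr => f _; rewrite Hl big_distrl.
Qed.

(* Exponential polynomials have no negative coefficients: a relation is the
   zero set of a difference [P - Q] which is nonnegative everywhere. *)
Definition dio k (R : (nat -> nat) -> (nat -> nat) -> bool) : Prop :=
  exists P Q, [/\ expoly k P, expoly k Q, forall e x, Q e x <= P e x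
    & forall e x, R e x = (P e x == Q e x)].

Lemma dio_ext k R S : dio k R -> (forall e x, R e x = S e x) -> dio k S.
Proof. by move=> [P [Q [HP HQ le E]]] RS; exists P, Q; split=> // e x; rewrite -RS. Qed.

(** The nonnegative difference is [(P - Q) ^ 2]. *)
Lemma dio_eq k P Q : expoly k P -> expoly k Q -> dio k (fun e x => P e x == Q e x).
Proof.
move=> HP HQ; have H2 := expoly_coef k (def_const 2).
exists (fun e x => P e x * P e x + Q e x * Q e x), (fun e x => 2 * (P e x * Q e x)).
have C e x := nat_Cauchy (P e x) (Q e x).
split=> [||e x|e x]; first by apply: expoly_add; apply: expoly_mul.
- by do 2!apply: expoly_mul => //.
- exact: (C e x).1.
- by rewrite [RHS]eq_sym; exact: esym (C e x).2.
Qed.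

Lemma dio_and k R S : dio k R -> dio k S -> dio k (fun e x => R e x && S e x).
Proof.
move=> [P [Q [HP HQ le E]]] [P' [Q' [HP' HQ' le' E']]].
exists (fun e x => P e x + P' e x), (fun e x => Q e x + Q' e x).
split=> [||e x|e x]; try exact: expoly_add.
  by rewrite leq_add.
rewrite E E'; have := le e x; have := le' e x.
by move=> h h'; apply/andP/eqP => [[/eqP-> /eqP->//] | Es]; split; apply/eqP; lia.
Qed.

(** The new difference is the product [(P - Q) * (P' - Q')], expanded. *)
Lemma dio_or k R S : dio k R -> dio k S -> dio k (fun e x => R e x || S e x).
Proof.
move=> [P [Q [HP HQ le E]]] [P' [Q' [HP' HQ' le' E']]].
exists (fun e x => P e x * P' e x + Q e x * Q' e x), (fun e x => P e x * Q' e x + Q e x * P' e x).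
split=> [||e x|e x]; try by apply: expoly_add; apply: expoly_mul.
  by have := le e x; have := le' e x; nia.
rewrite E E' -(subnKC (le e x)) -(subnKC (le' e x)).
move: (Q e x) (Q' e x) (P e x - Q e x) (P' e x - Q' e x) => q q' v u.
have -> : (q + v) * (q' + u) + q * q' = u * v + ((q + v) * q' + q * (q' + u)) by lia.
rewrite -[X in _ = (_ == X)]add0n eqn_add2r muln_eq0 -{2}(addn0 q) -{2}(addn0 q').
by rewrite !eqn_add2l orbC.
Qed.

(* With [D = P - Q <= 2 ^ u], the number [(2 ^ u - 1) * D] has [u] binary ones
   when [D] is nonzero, and none otherwise; these numbers are the digits in base
   [4 ^ u] of a single number, whose binary digits are then counted. *)
Lemma def_box_count k R U : dio k R -> def U ->
  def (fun e => \sum_(f : {ffun 'I_k -> 'I_(U e).+1}) R e (ffun_ext f)).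
Proof.
move=> [P [Q [HP HQ le E]]] HU.
pose u e := (P e (fun=> U e)).+1.
have Hu : def u by apply: def_succ; apply: (def_expoly (s := fun e _ => U e)) HP _.
pose W e := 2 ^ (2 * u e).
have HW : def W := def_pow2 (def_mul (def_const 2) Hu).
have W1 e : 1 < W e by apply: leq_ltn_trans (ltn_expl _ (ltnSn 1)); rewrite muln_gt0.
pose D e (f : {ffun 'I_k -> 'I_(U e).+1}) := P e (ffun_ext f) - Q e (ffun_ext f).
have Du e f : @D e f <= 2 ^ u e.
  apply: leq_trans (ltnW (ltn_expl (u e) (ltnSn 1))).
  apply: leq_trans (leq_subr _ _) (leqW _); apply: (expoly_leq e HP) => i _.
  by have := ffun_ext_lt f i.
have HS := def_sub (def_box_sum HP HU HW W1) (def_box_sum HQ HU HW W1).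
have Hh := def_hw (def_mul (def_sub (def_pow2 Hu) (def_const 1)) HS).
(* The digit sum divided by [u] counts the nonzero values; the zeros are the other points of the
   box. *)
apply: def_ext (def_sub (def_exp (def_succ HU) (def_const k)) (def_div Hh Hu)) _ => e.
rewrite -sumnB; last by move=> f _; rewrite leq_mul2r le orbT.
have -> : (2 ^ u e - 1) * \sum_(f : {ffun 'I_k -> 'I_(U e).+1})
            (P e (ffun_ext f) * W e ^ ffun_rank f - Q e (ffun_ext f) * W e ^ ffun_rank f)
        = \sum_(f : {ffun 'I_k -> 'I_(U e).+1}) ((2 ^ u e).-1 * @D e f) * W e ^ ffun_rank f.
  by rewrite subn1 big_distrr /=; apply: eq_bigr => f _; rewrite /D -mulnBl mulnA.
rewrite hw_sum_inj; [| exact: ffun_rank_inj |]; last first.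
  move=> f; rewrite mul2n -addnn expnD; have := Du e f; have := expn_gt0 2 (u e).
  by move: (2 ^ u e) (D e f) => p d; nia.
under eq_bigr => f _ do rewrite hw_mersenne_mul //.
rewrite -big_distrr mulKn //=.
have -> : (U e).+1 ^ k = \sum_(f : {ffun 'I_k -> 'I_(U e).+1}) 1.
  by rewrite sum1_card card_ffun !card_ord.
rewrite -sumnB => [|f _]; last exact: leq_b1.
by apply: eq_bigr => f _; rewrite E /D subn_gt0 ltn_neqAle le andbT eq_sym; case: eqP.
Qed.

(** * Graphs of terms *)

Definition seg (X : nat -> nat) (b n : nat) : seq nat := [seq X i | i <- iota b n].

Lemma segD X b m n : seg X b (m + n) = seg X b m ++ seg X (b + m) n.
Proof. by rewrite /seg iotaD map_cat. Qed.

Lemma size_seg X b n : size (seg X b n) = n.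
Proof. by rewrite size_map size_iota. Qed.

Lemma last_seg X b n : last 0 (seg X b n.+1) = X (b + n).
Proof. by rewrite -addn1 segD last_cat. Qed.

(* [w e] lists the values of [f] and of auxiliary quantities, [f e] being last.
   All of them are determined by the environment, so that zeros of the relation
   below correspond to arguments of [f]. *)
Definition has_graph (f : (nat -> nat) -> nat) : Prop :=
  exists n (w : (nat -> nat) -> seq nat),
  [/\ forall e, size (w e) = n.+1 /\ last 0 (w e) = f e,
      exists2 B, def B & forall e e', (forall i, e i <= e' i) ->
        all (fun z => z <= B e') (w e)
    & forall k b, 0 < k -> b + n.+1 <= k ->
        dio k (fun e X => seg X b n.+1 == w (scons (X 0) e))].

Lemma has_graph_op (c : nat) (o : nat -> nat -> seq nat) f g :
  (forall x y, size (o x y) = c.+1) ->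
  (forall F G, def F -> def G -> exists2 B, def B &
     forall e x y, x <= F e -> y <= G e -> all (fun z => z <= B e) (o x y)) ->
  (forall k b p q, p < k -> q < k -> b + c.+1 <= k ->
     dio k (fun e X => seg X b c.+1 == o (X p) (X q))) ->
  has_graph f -> has_graph g ->
  has_graph (fun e => last 0 (o (f e) (g e))).
Proof.
move=> so Bo Do [n [w [sw [B HB wB] Dw]]] [n' [w' [sw' [B' HB' wB'] Dw']]].
exists (n.+1 + (n'.+1 + c)), (fun e => w e ++ (w' e ++ o (f e) (g e))); split.
- move=> e; rewrite !size_cat so (sw e).1 (sw' e).1 !addnS; split=> //.
  by rewrite !last_cat; case: (o _ _) (so (f e) (g e)).
- have [Bc HBc oB] := Bo _ _ HB HB'.
  exists (fun e => B e + (B' e + Bc e)); first by do 2!apply: def_add => //.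
  have last_le (s : seq nat) M : all (fun z => z <= M) s -> last 0 s <= M.
    by move=> /allP sM; have := mem_last 0 s; rewrite inE => /orP[/eqP-> // | /sM].
  move=> e e' le; rewrite !all_cat; apply/and3P; split.
  + by apply: sub_all (wB _ _ le) => z; lia.
  + by apply: sub_all (wB' _ _ le) => z; lia.
  + apply: sub_all (oB e' (f e) (g e) _ _) => [z||]; first by lia.
      by rewrite -(sw e).2; apply: last_le; apply: wB.
    by rewrite -(sw' e).2; apply: last_le; apply: wB'.
- move=> k b k0 bk.
  have D1 := Dw k b k0 ltac:(lia).
  have D2 := Dw' k (b + n.+1) k0 ltac:(lia).
  (* Coordinates [b + n] and [b + n.+1 + n'] end the first two segments: they hold [f e] and
     [g e]. *)
  have D3 := Do k (b + n.+1 + n'.+1) (b + n) (b + n.+1 + n') ltac:(lia) ltac:(lia) ltac:(lia).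
  apply: dio_ext (dio_and D1 (dio_and D2 D3)) _ => e X.
  have -> : (n.+1 + (n'.+1 + c)).+1 = n.+1 + (n'.+1 + c.+1) by lia.
  rewrite segD eqseq_cat ?size_seg ?(sw _).1 // segD eqseq_cat ?size_seg ?(sw' _).1 //.
  case: eqP => //= E1; case: eqP => //= E2.
  by rewrite -last_seg E1 -last_seg E2 (sw _).2 (sw' _).2.
Qed.

Lemma has_graph_ext f g : has_graph f -> (forall e, f e = g e) -> has_graph g.
Proof.
by move=> [n [w [sw Bw Dw]]] fg; exists n, w; split=> // e; rewrite -fg.
Qed.

Lemma has_graph_expoly f : def f ->
  (forall e e', (forall i, e i <= e' i) -> f e <= f e') ->
  (forall k, 0 < k -> expoly k (fun e X => f (scons (X 0) e))) ->
  has_graph f.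
Proof.
move=> Hf fle Ef; exists 0, (fun e => [:: f e]); split=> //.
  by exists f => // e e' le /=; rewrite fle.
move=> k b k0 bk; have bk' : b < k by lia.
apply: dio_ext (dio_eq (expoly_var bk') (Ef k k0)) _ => e X /=.
by rewrite eqseq_cons andbT.
Qed.

Lemma has_graph_add f g : has_graph f -> has_graph g -> has_graph (fun e => f e + g e).
Proof.
apply: (@has_graph_op 0 (fun x y => [:: x + y])) => // [F G HF HG|k b p q pk qk bk].
  exists (fun e => F e + G e); first exact: def_add.
  by move=> e x y xF yG; rewrite /= leq_add.
have bk' : b < k by lia.
apply: dio_ext (dio_eq (expoly_var bk') (expoly_add (expoly_var pk) (expoly_var qk))) _ => e X.
by rewrite eqseq_cons andbT.
Qed.

Lemma has_graph_mul f g : has_graph f -> has_graph g -> has_graph (fun e => f e * g e).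
Proof.
apply: (@has_graph_op 0 (fun x y => [:: x * y])) => // [F G HF HG|k b p q pk qk bk].
  exists (fun e => F e * G e); first exact: def_mul.
  by move=> e x y xF yG; rewrite /= leq_mul.
have bk' : b < k by lia.
apply: dio_ext (dio_eq (expoly_var bk') (expoly_mul (expoly_var pk) (expoly_var qk))) _ => e X.
by rewrite eqseq_cons andbT.
Qed.

Lemma has_graph_pow2 f : has_graph f -> has_graph (fun e => 2 ^ f e).
Proof.
move=> Hf; apply: (@has_graph_op 0 (fun x _ => [:: 2 ^ x]) f f) => // [F G HF HG|k b p q pk qk bk].
  exists (fun e => 2 ^ F e); first exact: def_pow2.
  by move=> e x y xF yG; rewrite /= leq_pexp2l.
have bk' : b < k by lia.
apply: dio_ext (dio_eq (expoly_var bk') (expoly_pow2 pk)) _ => e X.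
by rewrite eqseq_cons andbT.
Qed.

(* [z = x - y] and [s = y - x] is equivalent to [x + s = y + z] and [z * s = 0]. *)
Lemma has_graph_sub f g : has_graph f -> has_graph g -> has_graph (fun e => f e - g e).
Proof.
apply: (@has_graph_op 1 (fun x y => [:: y - x; x - y])) => // [F G HF HG|k b p q pk qk bk].
  exists (fun e => F e + G e); first exact: def_add.
  by move=> e x y xF yG; rewrite /= andbT; apply/andP; split; lia.
have V i : b + i < k -> expoly k (fun _ X => X (b + i)) := @expoly_var k (b + i).
have b0 := V 0 ltac:(lia); have b1 := V 1 ltac:(lia).
have H := dio_and (dio_eq (expoly_add (expoly_var pk) b0) (expoly_add (expoly_var qk) b1))
            (dio_eq (expoly_mul b1 b0) (expoly_coef k (def_const 0))).
apply: dio_ext H _ => e X; rewrite /seg /= !eqseq_cons andbT addn0 addn1 muln_eq0.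
apply/andP/andP; first by case=> /eqP h /orP[] /eqP h'; split; apply/eqP; lia.
by case=> /eqP h /eqP h'; split; [apply/eqP | apply/orP; case: (leqP (X p) (X q)) => ?; [left | right]; apply/eqP]; lia.
Qed.

(** The relation is [x = z * y + r] together with either [r + s + 1 = y], where the slack [s]
    expresses [r < y], or [y + z + s = 0], the case of division by zero. *)
Lemma has_graph_div f g : has_graph f -> has_graph g -> has_graph (fun e => f e %/ g e).
Proof.
apply: (@has_graph_op 2 (fun x y => [:: x %% y; y - (x %% y).+1; x %/ y])) => // [F G HF HG|k b p q pk qk bk].
  exists (fun e => F e + G e); first exact: def_add.
  move=> e x y xF yG; rewrite /= andbT; apply/and3P.
  by have := leq_mod x y; have := leq_div x y; split; lia.
have V i : b + i < k -> expoly k (fun _ X => X (b + i)) := @expoly_var k (b + i).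
have b0 := V 0 ltac:(lia); have b1 := V 1 ltac:(lia); have b2 := V 2 ltac:(lia).
have C c := expoly_coef k (def_const c).
have H := dio_and (dio_eq (expoly_var pk) (expoly_add (expoly_mul b2 (expoly_var qk)) b0))
            (dio_or (dio_eq (expoly_add (expoly_add b0 b1) (C 1)) (expoly_var qk))
              (dio_eq (expoly_add (expoly_var qk) (expoly_add b2 b1)) (C 0))).
apply: dio_ext H _ => e X; rewrite /seg /= !eqseq_cons andbT addn0 !(addn1, addn2).
move: (X p) (X q) (X b) (X b.+1) (X b.+2) => x y r s z.
apply/andP/and3P.
  case=> /eqP -> /orP[/eqP <-|].
    have lt : r < (r + s).+1 by lia.
    rewrite modnMDl modn_small // divnMDl ?divn_small ?ltn0Sn ?addn0 //.
    by split; apply/eqP; lia.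
  rewrite !addn_eq0 => /and3P[/eqP-> /eqP-> /eqP->].
  by rewrite mul0n add0n modn0 divn0 sub0n.
case=> /eqP-> /eqP-> /eqP->; rewrite -divn_eq; split=> //.
case: y => [|y]; first by rewrite divn0 sub0n orbT.
by have := ltn_pmod x (ltn0Sn y) => lt; apply/orP; left; apply/eqP; lia.
Qed.

Lemma has_graph_def f : def f -> has_graph f.
Proof.
case=> t Ht; apply: (@has_graph_ext (fun e => ev e t)) => {f Ht} //.
elim: t => [i|c|||||] /=; try by eauto using has_graph_add, has_graph_sub,
  has_graph_mul, has_graph_div, has_graph_pow2.
- apply: has_graph_expoly => [||k k0]; [exact: def_var | by move=> e e' | ].
  by case: i => [|i]; [exact: expoly_var | exact: expoly_coef (def_var i)].
- apply: has_graph_expoly => // [|k k0]; first exact: def_const.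
  exact: expoly_coef (def_const c).
Qed.

(** * Bounded sums *)

Lemma def_scons f x : def f -> def x -> def (fun e => f (scons (x e) e)).
Proof. by move=> Hf Hx; apply: def_comp Hf _ => -[|i] //=; apply: def_var. Qed.

(** A zero [x] corresponds to exactly one point of a box: coordinate 0 is [x], the others form the
    list [w], and the last one is 0. As the box may extend beyond [T], all zeros are assumed to lie
    below [T]. *)
Lemma def_count_bounded f T : def f -> def T ->
  (forall e x, f (scons x e) = 0 -> x < T e) ->
  def (fun e => \sum_(x < T e) (f (scons x e) == 0)).
Proof.
move=> Hf HT fT; have [n [w [sw [B HB wB] Dw]]] := has_graph_def Hf.
pose U e := B (scons (T e) e) + T e.
have HU : def U := def_add (def_scons HB HT) HT.
have D := dio_and (Dw n.+2 1 (ltn0Sn _) (leqnn _))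
            (dio_eq (expoly_var (ltnSn n.+1)) (expoly_coef n.+2 (def_const 0))).
apply: def_ext (def_box_count D HU) _ => e.
pose h (x : 'I_(T e)) : {ffun 'I_n.+2 -> 'I_(U e).+1} :=
  [ffun i : 'I_n.+2 => inord (nth 0 ((x : nat) :: w (scons x e)) i)].
have hE x i : i < n.+2 -> ffun_ext (h x) i = nth 0 ((x : nat) :: w (scons x e)) i.
  move=> ik; rewrite (ffun_extE _ (Ordinal ik)) ffunE inordK // ltnS /U.
  case: i ik => [|i] ik /=; first by rewrite ltnW // ltn_addl.
  apply: leq_trans (leq_addr _ _).
  have /allP := wB (scons x e) (scons (T e) e) ltac:(case=> //= ; exact: ltnW).
  by apply; apply: mem_nth; rewrite (sw _).1.
have h_inj : injective h.
  move=> x y hxy; apply: val_inj => /=.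
  by rewrite -[LHS](hE x 0 isT) hxy hE.
have seg_h x : seg (ffun_ext (h x)) 1 n.+1 = w (scons (x : nat) e).
  apply: (@eq_from_nth _ 0); rewrite size_seg ?(sw _).1 // => i ik.
  by rewrite /seg (nth_map 0) ?size_iota // nth_iota // hE.
rewrite -!big_mkcond !sum1_card.
transitivity #|[set h x | x in [pred x : 'I_(T e) | f (scons x e) == 0]]|; last first.
  by rewrite card_imset //; apply: eq_card.
apply: eq_card => F; apply/idP/imsetP.
  rewrite unfold_in => /andP[/eqP segF /eqP F0].
  have f0 : f (scons (ffun_ext F 0) e) = 0.
    by rewrite -(sw _).2 -segF last_seg.
  exists (Ordinal (fT _ _ f0)); first by rewrite inE /= f0.
  apply/ffunP => i; apply: val_inj; rewrite /= -!ffun_extE hE //=.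
  case: i => -[|i] ik //=; rewrite -segF /seg (nth_map 0) ?size_iota //.
  by rewrite nth_iota.
case=> x; rewrite inE => /eqP fx ->; rewrite unfold_in hE // seg_h (hE _ n.+1) //=.
rewrite eqxx /= -fx -(sw _).2; apply/eqP.
by case: (w _) (sw (scons x e)).1 => //= y s [<-]; rewrite nth_last.
Qed.

Lemma def_weaken f : def f -> def (fun e => f (fun i => e i.+1)).
Proof. by move=> Hf; apply: def_comp Hf _ => i; apply: def_var. Qed.

Lemma def_count (p : (nat -> nat) -> bool) T : def p -> def T ->
  def (fun e => \sum_(x < T e) p (scons x e)).
Proof.
move=> Hp HT.
(* The sum [(1 - p) + (x.+1 - T)] vanishes exactly when [p] holds and [x < T]. *)
have H := def_add (def_sub (def_const 1) Hp)
   (def_sub (def_succ (def_var 0)) (def_weaken HT)).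
apply: def_ext (def_count_bounded H HT _) _ => [e x|e] /=.
  by move/eqP; rewrite addn_eq0 => /andP[_]; rewrite subn_eq0.
apply: eq_bigr => x _; rewrite /= addn_eq0 [x.+1 - T e == 0]subn_eq0 ltn_ord andbT.
by case: (p _).
Qed.

Lemma sum_divn_modn (F : nat -> nat -> nat) t u : 0 < u ->
  \sum_(y < t * u) F (y %/ u) (y %% u) = \sum_(x < t) \sum_(z < u) F x z.
Proof.
move=> u0; elim: t => [|t IH]; first by rewrite !big_ord0.
rewrite mulSnr big_split_ord big_ord_recr -IH; congr (_ + _).
by apply: eq_bigr => z _; rewrite /= divnMDl // modnMDl divn_small ?modn_small ?addn0.
Qed.

Lemma sum_ltn_nat m u : \sum_(z < u) (z < m) = minn u m.
Proof.
elim: u => [|u IH]; first by rewrite big_ord0 min0n.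
by rewrite big_ord_recr /= IH; case: ltnP; lia.
Qed.

(* [y < T * U] encodes the pair [(y %/ U, y %% U)], where [U] bounds [f]. *)
Lemma def_sum f T : def f -> def T -> def (fun e => \sum_(x < T e) f (scons x e)).
Proof.
move=> Hf HT; have [n [w [sw [B HB wB] _]]] := has_graph_def Hf.
pose U e := (B (scons (T e) e)).+1.
have HU : def U := def_succ (def_scons HB HT).
have fU e x : x < T e -> f (scons x e) < U e.
  move=> xT; rewrite ltnS -(sw _).2.
  have /allP := wB (scons x e) (scons (T e) e) ltac:(case=> //= ; exact: ltnW).
  apply; case: (w _) (sw (scons x e)).1 => //= y s _; exact: mem_last.
have HU' := def_weaken HU.
have H0 := def_comp (s := fun e => scons (e 0 %/ U (fun i => e i.+1)) (fun i => e i.+1)) Hf.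
(* A value of [f] is the number of [z < U] below it, so the sum counts pairs [(x, z)]. *)
have H : def (fun e => e 0 %% U (fun i => e i.+1) <
     f (scons (e 0 %/ U (fun i => e i.+1)) (fun i => e i.+1)) : nat).
  apply: def_ltn; first exact: def_mod (def_var 0) HU'.
  apply: H0 => -[|i] /=; [exact: def_div (def_var 0) HU' | exact: def_var].
apply: def_ext (def_count H (def_mul HT HU)) _ => e /=.
have U0 : 0 < U e by [].
rewrite (sum_divn_modn (fun x z => z < f (scons x e) : nat)) //.
by apply: eq_bigr => x _; rewrite sum_ltn_nat; apply/minn_idPr/ltnW/fU.
Qed.

(** * Recurrent sequences *)

Lemma def_aeval m (v : (nat -> nat) -> m.-tuple nat) (t : aterm m) :
  (forall i, def (fun e => tnth (v e) i)) -> def (fun e => aeval (v e) t).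
Proof.
move=> Hv; elim: t => /=;
  eauto using def_const, def_add, def_sub, def_mul, def_div, def_mod, def_exp.
Qed.

Lemma def_table k (a : nat -> nat) f : def f -> def (fun e => if f e < k then a (f e) else 0).
Proof.
move=> Hf; have H i := def_mul (def_eqn Hf (def_const i)) (def_const (a i)).
apply: def_ext (def_bigsum (index_enum 'I_k) (fun i => H (val i))) _ => e /=.
case: ltnP => [fk | kf].
  rewrite (bigD1 (Ordinal fk)) //= eqxx mul1n big1 ?addn0 // => i.
  by rewrite -val_eqE /= eq_sym => /negbTE->.
by rewrite big1 // => i _; have := ltn_ord i; case: eqP => //; lia.
Qed.

Definition digit (b c j : nat) : nat := c %/ b ^ j %% b.

Definition digits_follow k (F : aterm k.+1) (a : nat -> nat) (b c j : nat) : bool :=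
  digit b c j == if j < k then a j else
    aeval [tuple of j - k :: [tuple digit b c (j - k + i) | i < k]] F.

(** Strong induction: once the earlier digits agree with [a], the value prescribed at [j] is
    [a j]. *)
Lemma digits_follow_all k (F : aterm k.+1) (a : nat -> nat) b c n :
  (forall n, a (n + k) = aeval [tuple of n :: [tuple a (n + i) | i < k]] F) ->
  (forall j, j < n -> digits_follow F a b c j) <-> (forall j, j < n -> digit b c j = a j).
Proof.
move=> ha; have step j : (forall i, i < j -> digit b c i = a i) ->
    digits_follow F a b c j = (digit b c j == a j).
  move=> IH; rewrite /digits_follow; case: ltnP => // kj.
  rewrite -[in a j](subnK kj) ha; congr (_ == aeval _ F).
  apply: eq_from_tnth => i; case: (unliftP ord0 i) => [l -> | -> //].
  by rewrite !tnthS !tnth_mktuple IH // -[ltnRHS](subnK kj) ltn_add2l (ltn_ord l).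
split=> H j jn; last by rewrite step ?H // => i ij; apply: H; apply: ltn_trans jn.
elim/ltn_ind: j jn => j IH jn; apply/eqP; rewrite -step ?H // => i ij.
by apply: IH; rewrite // (ltn_trans ij).
Qed.

Lemma def_recurrence k (F : aterm k.+1) (a : nat -> nat) :
  (forall n, a (n + k) = aeval [tuple of n :: [tuple a (n + i) | i < k]] F) ->
  exists2 G, def G & forall e, (forall j, j <= e 0 -> a j < e 1) -> G e = a (e 0).
Proof.
move=> ha.
have Hdigit f g h : def f -> def g -> def h -> def (fun e => digit (f e) (g e) (h e)).
  by move=> Hf Hg Hh; exact: def_mod (def_div Hg (def_exp Hf Hh)) Hf.
have V := def_var.
(* Under two binders the variables 0 to 3 are the index [j], the code [c], then [n] and [b]. *)
pose follow (e : nat -> nat) := digits_follow F a (e 3) (e 1) (e 0).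
have Hfollow : def (fun e => ~~ follow e).
  have Hr : def (fun e => aeval
      [tuple of e 0 - k :: [tuple digit (e 3) (e 1) (e 0 - k + i) | i < k]] F).
    apply: def_aeval => i; have Hj := def_sub (V 0) (def_const k).
    case: (unliftP ord0 i) => [j -> | ->]; last exact: def_ext Hj _.
    apply: def_ext (Hdigit _ _ _ (V 3) (V 1) (def_add Hj (def_const j))) _ => e.
    by rewrite tnthS tnth_mktuple.
  have Hb := def_mul (def_sub (def_const 1) (def_ltn (V 0) (def_const k))) Hr.
  have He := def_eqn (Hdigit _ _ _ (V 3) (V 1) (V 0)) (def_add (def_table k a (V 0)) Hb).
  apply: def_ext (def_sub (def_const 1) He) _ => e.
  rewrite /follow /digits_follow; case: ltnP => _; rewrite ?mul0n ?addn0 ?mul1n ?add0n;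
  by case: eqP.
pose valid (e : nat -> nat) := \sum_(j < (e 1).+1) ~~ follow (scons j e) == 0.
have Hvalid : def valid.
  apply: def_eqn (def_count (p := fun e => ~~ follow e) Hfollow (def_succ (V 1))) (def_const 0).
have HT : def (fun e => e 1 ^ (e 0).+1) := def_exp (V 1) (def_succ (V 0)).
have Hden := def_sum Hvalid HT.
have Hnum := def_sum (def_mul Hvalid (Hdigit _ _ _ (V 2) (V 0) (V 1))) HT.
eexists; first exact: def_div Hnum Hden.
move=> e ab /=; set n := e 0; set b := e 1.
have validE c : valid (scons c e) <-> forall j, j < n.+1 -> digit b c j = a j.
  rewrite -(digits_follow_all b c n.+1 ha) /valid /= sum_nat_eq0.
  split=> [/forallP H j jn | H]; first by have := H (Ordinal jn); rewrite /= eqb0 negbK.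
  by apply/forallP => j; rewrite /= eqb0 negbK; exact: (H j (ltn_ord j)).
(* The code of the actual sequence is valid, which makes the denominator positive. *)
pose c0 := \sum_(j < n.+1) a j * b ^ j.
have c0T : c0 < b ^ n.+1 by apply: sum_digits_lt.
(* All valid codes have the same leading digit [a n], which factors out of the numerator. *)
rewrite (eq_bigr (fun c : 'I_(b ^ n.+1) => valid (scons c e) * a n)); last first.
  by move=> c _; case: (boolP (valid _)) => // /validE /(_ n (ltnSn n)) <-.
rewrite -big_distrl /= mulKn // (bigD1 (Ordinal c0T)) //= addn_gt0 lt0b.
apply/orP; left; apply/validE => j jn; exact: digit_sum.
Qed.

(** * Translation into the language with [A] *)

Lemma lterm_of_tm k (t : tm) : exists T : lterm k.+1 k.+1, forall A v,
  leval A v T = ev (fun i => if i is 0 then tnth v ord0 else A v) t.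
Proof.
(* Constants are rebuilt from [x - x = 0] and [2 ^ 0 = 1]. *)
pose zero : lterm k.+1 k.+1 := LSub (LVar _ ord0) (LVar _ ord0).
elim: t => [[|i]|c|s [S HS] t [T HT]|s [S HS] t [T HT]|s [S HS] t [T HT]|s [S HS] t [T HT]|t [T HT]].
- by exists (LVar _ ord0).
- exists (LApp (fun j => LVar _ j)) => A v /=; congr (A _).
  by apply: eq_from_tnth => j; rewrite tnth_mktuple.
- elim: c => [|c [T HT]]; first by exists zero => A v /=; rewrite subnn.
  by exists (LAdd T (LPow2 zero)) => A v /=; rewrite HT subnn /= addn1.
- by exists (LAdd S T) => A v /=; rewrite HS HT.
- by exists (LSub S T) => A v /=; rewrite HS HT.
- by exists (LMul S T) => A v /=; rewrite HS HT.
- by exists (LDiv S T) => A v /=; rewrite HS HT.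
- by exists (LPow2 T) => A v /=; rewrite HT.
Qed.

Unset Implicit Arguments.

Theorem theorem2 (k : nat) (hk : 1 <= k)
  (F : aterm k.+1) (a : nat -> nat)
  (ha : forall n : nat,
      a (n + k) = aeval [tuple of n :: [tuple a (n + i) | i < k]] F)
  (A : k.+1.-tuple nat -> nat)
  (hA : forall n j : nat, j <= n ->
      a j < A [tuple of n :: [tuple a i | i < k]]) :
  exists T : lterm k.+1 k.+1, forall n : nat,
    a n = leval A [tuple of n :: [tuple a i | i < k]] T.
Proof.
have [G [t Ht] Ga] := def_recurrence ha.
have [T HT] := lterm_of_tm k t.
by exists T => n; rewrite HT -Ht Ga // => j; apply: hA.
Qed.
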